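(* Let $F$ be an $M\times N$ unit norm frame and suppose $N\geq M^2+3M+3$. Then the linear-time flipping algorithm, applied to $F$, outputs an $M\times N$ frame $G$ that is flipping equivalent to $F$ and satisfies $\nu_G\leq\frac{\mu_G}{\sqrt{M}}$.
   Context: An $M\times N$ unit norm frame is a complex $M\times N$ matrix of rank $M$ whose columns $f_1,\ldots,f_N$ have Euclidean norm $1$. Frames $F$ and $G$ are flipping equivalent if $G=FD$ for some diagonal matrix $D$ with all diagonal entries in $\{+1,-1\}$. The worst-case coherence is $\mu_F:=\max_{i\neq j}|\langle f_i,f_j\rangle|$ and the average coherence is $\nu_F:=\frac{1}{N-1}\max_{i\in\{1,\ldots,N\}}\big|\sum_{j\neq i}\langle f_i,f_j\rangle\big|$, where $i,j$ range over $\{1,\ldots,N\}$. Linear-time flipping algorithm: the input is an $M\times N$ unit norm frame $F$ with columns $f_1,\ldots,f_N$; the output is the matrix $G$ with columns $g_1,\ldots,g_N$ defined recursively as follows. Set $g_1:=f_1$. For $n=2,\ldots,N$ in order: if $\big\|\sum_{i=1}^{n-1}g_i+f_n\big\|\leq\big\|\sum_{i=1}^{n-1}g_i-f_n\big\|$, set $g_n:=f_n$; otherwise set $g_n:=-f_n$. *)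

(* Defs.v *)
From mathcomp Require Import all_boot all_order all_algebra.
From mathcomp Require Import complex reals.
Set Implicit Arguments.
Unset Strict Implicit.
Unset Printing Implicit Defensive.
Import Order.TTheory GRing.Theory Num.Theory.
Local Open Scope ring_scope.

Section Frames.
Variable R : realType.
Local Notation C := (R[i]).

(* [dotmx] is the Hermitian product of row vectors, conjugate-linear on the
   right. *)
Definition cdot (M : nat) (u v : 'cV[C]_M) : C := dotmx u^T v^T.

Lemma cdotE (M : nat) (u v : 'cV[C]_M) :
  cdot u v = \sum_(k < M) u k 0 * conjc (v k 0).
Proof.
by rewrite /cdot dotmxE mxE; apply: eq_bigr => k _; rewrite !mxE.
Qed.

(* [cdot v v] is real and nonnegative, so taking its real part loses nothing. *)
Definition enorm (M : nat) (v : 'cV[C]_M) : R :=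
  Num.sqrt (complex.Re (cdot v v)).

Definition unit_norm_frame (M N : nat) (F : 'M[C]_(M, N)) : Prop :=
  \rank F = M /\ forall i : 'I_N, enorm (col i F) = 1.

Definition flipping_equivalent (M N : nat) (F G : 'M[C]_(M, N)) : Prop :=
  exists2 d : 'rV[C]_N,
    forall i : 'I_N, d 0 i = 1 \/ d 0 i = -1 & G = F *m diag_mx d.

Local Notation normc := ComplexField.Normc.normc.

(* All the maximized quantities are nonnegative, so the default value 0 of the
   iterated maximum does not affect it as soon as the index set is nonempty. *)
Definition worst_coherence (M N : nat) (F : 'M[C]_(M, N)) : R :=
  \big[Num.max/0]_(i < N) \big[Num.max/0]_(j < N | i != j)
    normc (cdot (col i F) (col j F)).

Definition average_coherence (M N : nat) (F : 'M[C]_(M, N)) : R :=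
  (N%:R - 1)^-1 * \big[Num.max/0]_(i < N)
    normc (\sum_(j < N | j != i) cdot (col i F) (col j F)).

(* [gs] lists the columns g_1, ..., g_(n-1) already chosen and [f] is f_n. *)
Definition flip_next (M : nat) (gs : seq 'cV[C]_M) (f : 'cV[C]_M) : 'cV[C]_M :=
  if gs is [::] then f
  else let s := \sum_(g <- gs) g in
       if enorm (s + f) <= enorm (s - f) then f else - f.

Definition flip_columns (M : nat) (fs : seq 'cV[C]_M) : seq 'cV[C]_M :=
  foldl (fun gs f => rcons gs (flip_next gs f)) [::] fs.

Definition linear_time_flipping (M N : nat) (F : 'M[C]_(M, N)) : 'M[C]_(M, N) :=
  let gs := flip_columns [seq col i F | i <- enum 'I_N] in
  \matrix_(k < M, n < N) (nth 0 gs n) k 0.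

End Frames.

(* Main.v *)
(* By the choice of signs, each column added by the algorithm increases the
   squared norm of the running sum by at most 1, so the sum S of all columns has
   norm at most sqrt N, and |<g_i, S> - 1| <= sqrt N + 1 bounds the average
   coherence by 1 / (sqrt N - 1). The worst-case coherence is bounded below by
   the Welch bound sqrt ((N - M) / (M (N - 1))), and N >= M^2 + 3M + 3 makes the
   former at most the latter divided by sqrt M. *)
Require Import Defs.
From mathcomp Require Import all_boot all_order all_algebra.
From mathcomp Require Import complex reals.
From mathcomp Require Import ring lra.
Import Order.TTheory GRing.Theory Num.Theory.
Local Open Scope ring_scope.

Section DotProduct.
Variables (C : numClosedFieldType) (n : nat).
Implicit Types u v : 'rV[C]_n.

Lemma dotmx_CauchySchwarz u v : `|dotmx u v| ^+ 2 <= dotmx u u * dotmx v v.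
Proof. exact: CauchySchwarz. Qed.

Lemma dotmx_parallelogram u v :
  dotmx (u + v) (u + v) + dotmx (u - v) (u - v) = (dotmx u u + dotmx v v) *+ 2.
Proof. rewrite !linearDl !linearDr !linearNl !linearNr; ring. Qed.

Lemma dotmxNN u : dotmx (- u) (- u) = dotmx u u.
Proof. by rewrite linearNl linearNr opprK. Qed.

End DotProduct.

Section Coherence.
Set Implicit Arguments.
Unset Strict Implicit.
Variable R : realType.
Local Notation C := (R[i]).
Local Notation normc := (@ComplexField.Normc.normc R).

Lemma normc_ge0 (z : C) : 0 <= normc z.
Proof. by case: z => a b; apply: sqrtr_ge0. Qed.

Lemma sqr_normcC (z : C) : (normc z ^+ 2)%:C%C = z * conjc z.
Proof. by rewrite rmorphXn /= -sqr_normc. Qed.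

Lemma normc_real (x : R) : normc x%:C%C ^+ 2 = x ^+ 2.
Proof. by apply: (@complexI R); rewrite sqr_normcC conjc_real -rmorphM. Qed.

(** Twice the difference of the two sides is the sum of [(a k - a l) ^+ 2] over all pairs [k],
    [l]. *)
Lemma sum_sqr_le (M : nat) (a : 'I_M -> R) :
  (\sum_k a k) ^+ 2 <= M%:R * \sum_k a k ^+ 2.
Proof.
have sqE : \sum_k \sum_(l < M) a k ^+ 2 = M%:R * \sum_k a k ^+ 2.
  by rewrite mulr_sumr; apply: eq_bigr => k _; rewrite sumr_const card_ord mulr_natl.
rewrite -(ler_pMn2r (isT : 0 < 2)%N) [leRHS]mulr2n -{1}sqE exchange_big /= -sqE.
rewrite expr2 mulr_suml -sumrMnl -big_split ler_sum // => k _ /=.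
rewrite mulr_sumr -sumrMnl -big_split ler_sum // => l _ /=.
by rewrite -subr_ge0 [X in 0 <= X](_ : _ = (a k - a l) ^+ 2) ?sqr_ge0//; ring.
Qed.

Lemma enorm_ge0 (M : nat) (v : 'cV[C]_M) : 0 <= enorm v.
Proof. exact: sqrtr_ge0. Qed.

(** Ties the real [enorm] to the complex [cdot]: real statements about norms are proved in [C] and
    pulled back along the embedding of [R]. *)
Lemma sqr_enormC (M : nat) (v : 'cV[C]_M) : (enorm v ^+ 2)%:C%C = cdot v v.
Proof.
have cdotE' : cdot v v = (\sum_k normc (v k 0) ^+ 2)%:C%C.
  by rewrite cdotE rmorph_sum; apply: eq_bigr => k _; rewrite /= sqr_normcC.
by rewrite /enorm cdotE' sqr_sqrtr //= sumr_ge0 // => k _; rewrite sqr_ge0.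
Qed.

Lemma sqr_enormE (M : nat) (v : 'cV[C]_M) :
  enorm v ^+ 2 = \sum_k normc (v k 0) ^+ 2.
Proof.
apply: (@complexI R); rewrite sqr_enormC cdotE rmorph_sum.
by apply: eq_bigr => k _; rewrite /= sqr_normcC.
Qed.

Lemma cdot_sumr (M N : nat) (P : pred 'I_N) (u : 'cV[C]_M) (v : 'I_N -> 'cV[C]_M) :
  cdot u (\sum_(j | P j) v j) = \sum_(j | P j) cdot u (v j).
Proof.
by rewrite /cdot linear_sum /= linear_sumr.
Qed.

Lemma normc_cdot_le (M : nat) (u v : 'cV[C]_M) :
  normc (cdot u v) <= enorm u * enorm v.
Proof.
have aux (a b c : C) (x y : R) : x%:C%C = a -> y%:C%C = b -> `|c| ^+ 2 <= a * b ->
    normc c ^+ 2 <= x * y.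
  by move=> <- <-; rewrite sqr_normc -sqr_normcC -rmorphM lecR.
rewrite -ler_sqr ?nnegrE ?mulr_ge0 ?enorm_ge0 ?normc_ge0 // exprMn.
exact: aux (sqr_enormC u) (sqr_enormC v) (dotmx_CauchySchwarz _ _ _ _).
Qed.

Lemma enorm_parallelogram (M : nat) (u v : 'cV[C]_M) :
  enorm (u + v) ^+ 2 + enorm (u - v) ^+ 2 = (enorm u ^+ 2 + enorm v ^+ 2) *+ 2.
Proof.
have aux (a b c d : C) (x y z t : R) :
    x%:C%C = a -> y%:C%C = b -> z%:C%C = c -> t%:C%C = d ->
    a + b = (c + d) *+ 2 -> x + y = (z + t) *+ 2.
  by move=> <- <- <- <-; rewrite -!rmorphD -rmorphMn => /complexI.
apply: aux (sqr_enormC _) (sqr_enormC _) (sqr_enormC _) (sqr_enormC _) _.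
by rewrite /cdot linearD linearB dotmx_parallelogram.
Qed.

Lemma enormN (M : nat) (v : 'cV[C]_M) : enorm (- v) = enorm v.
Proof.
by rewrite /enorm /cdot linearN dotmxNN.
Qed.

(* The two sums are the squared Frobenius norms of the Gram matrix [F^* F] and
   of the frame operator [F F^*]. *)
Lemma frame_potentialE (M N : nat) (F : 'M[C]_(M, N)) :
  \sum_i \sum_j normc (cdot (col i F) (col j F)) ^+ 2
    = \sum_k \sum_l normc (\sum_i F k i * conjc (F l i)) ^+ 2.
Proof.
apply: (@complexI R); rewrite !rmorph_sum /=.
(* Both sides expand to this fourfold sum. What follows moves the sums over [k] and [l] to the
   outside. *)
transitivity (\sum_i \sum_j \sum_k \sum_l
    F k i * conjc (F l i) * conjc (F k j * conjc (F l j))).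
  apply: eq_bigr => i _; rewrite rmorph_sum; apply: eq_bigr => j _ /=.
  rewrite sqr_normcC cdotE rmorph_sum big_distrlr /=.
  apply: eq_bigr => k _; apply: eq_bigr => l _.
  by rewrite !mxE !rmorphM /= !conjcK; ring.
transitivity (\sum_i \sum_k \sum_j \sum_l
    F k i * conjc (F l i) * conjc (F k j * conjc (F l j))).
  by apply: eq_bigr => i _; rewrite exchange_big.
rewrite exchange_big; apply: eq_bigr => k _ /=.
rewrite rmorph_sum /=.
transitivity (\sum_i \sum_l \sum_j
    F k i * conjc (F l i) * conjc (F k j * conjc (F l j))).
  by apply: eq_bigr => i _; rewrite exchange_big.
rewrite exchange_big; apply: eq_bigr => l _ /=.
by rewrite sqr_normcC rmorph_sum big_distrlr.
Qed.

(* Cauchy-Schwarz on the diagonal of [F F^*], whose trace is that of the Gram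
   matrix. *)
Lemma frame_potential_ge (M N : nat) (F : 'M[C]_(M, N)) :
  (\sum_i enorm (col i F) ^+ 2) ^+ 2
    <= M%:R * \sum_i \sum_j normc (cdot (col i F) (col j F)) ^+ 2.
Proof.
pose a k := \sum_i normc (F k i) ^+ 2.
have -> : \sum_i enorm (col i F) ^+ 2 = \sum_k a k.
  rewrite exchange_big /=; apply: eq_bigr => i _; rewrite sqr_enormE.
  by apply: eq_bigr => k _; rewrite mxE.
apply: le_trans (sum_sqr_le a) _; rewrite frame_potentialE ler_wpM2l ?ler0n //.
(* Of the inner sum only the diagonal term [l = k] is kept; the others are squares. *)
apply: ler_sum => k _; rewrite (bigD1 k) //=.
have -> : \sum_i F k i * conjc (F k i) = (a k)%:C%C.
  by rewrite rmorph_sum; apply: eq_bigr => i _; rewrite /= sqr_normcC.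
by rewrite normc_real lerDl sumr_ge0 // => l _; rewrite sqr_ge0.
Qed.

Lemma worst_coherence_ge0 (M N : nat) (F : 'M[C]_(M, N)) :
  0 <= worst_coherence F.
Proof. exact: bigmax_ge_id. Qed.

Lemma le_worst_coherence (M N : nat) (F : 'M[C]_(M, N)) (i j : 'I_N) :
  i != j -> normc (cdot (col i F) (col j F)) <= worst_coherence F.
Proof.
move=> ij; apply: (bigmax_sup i) => //.
exact: (le_bigmax_cond _ (fun j => normc (cdot (col i F) (col j F))) ij).
Qed.

(** The frame potential is at least $N^2/M$, while the Gram matrix has $N$ diagonal entries 1 and
    $N(N-1)$ others of modulus at most $\mu$. Cleared of denominators, the bound also makes sense
    for $N \le 1$. *)
Lemma welch_bound (M N : nat) (F : 'M[C]_(M, N)) :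
    (forall i, enorm (col i F) = 1) ->
  N%:R ^+ 2 <= M%:R * (N%:R + N%:R * (N%:R - 1) * worst_coherence F ^+ 2).
Proof.
move=> F1; have := frame_potential_ge F.
under eq_bigr do rewrite F1 expr1n.
rewrite sumr_const card_ord => /le_trans; apply; rewrite ler_wpM2l ?ler0n //.
have -> : N%:R + N%:R * (N%:R - 1) * worst_coherence F ^+ 2
    = \sum_(i < N) (1 + (N%:R - 1) * worst_coherence F ^+ 2).
  by rewrite sumr_const card_ord -[RHS]mulr_natl; ring.
apply: ler_sum => i _; rewrite (bigD1 i) //= -sqr_enormC F1 normc_real !expr1n.
rewrite lerD2l; have N0 := leq_ltn_trans (leq0n i) (ltn_ord i).
have -> : N%:R - 1 = #|predC1 i|%:R :> R by rewrite cardC1 card_ord -subn1 natrB.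
rewrite mulr_natl -sumr_const; apply: ler_sum => j ji.
by rewrite ler_sqr ?nnegrE ?normc_ge0 ?worst_coherence_ge0 // le_worst_coherence // eq_sym.
Qed.

Lemma average_coherence_le (M N : nat) (F : 'M[C]_(M, N)) :
    (forall i, enorm (col i F) = 1) -> (0 < N)%N ->
  average_coherence F <= (N%:R - 1)^-1 * (enorm (\sum_i col i F) + 1).
Proof.
move=> F1 N0; have N1 : 0 <= N%:R - 1 :> R by rewrite subr_ge0 ler1n.
rewrite ler_wpM2l ?invr_ge0 //; apply: bigmax_le => [|i _].
  (* The default value 0 of the maximum. *)
  by rewrite addr_ge0 ?enorm_ge0.
have -> : \sum_(j | j != i) cdot (col i F) (col j F)
    = cdot (col i F) (\sum_j col j F) - 1.
  (* The subtracted 1 is the missing term [j = i]. *)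
  by rewrite cdot_sumr [in RHS](bigD1 i) //= -sqr_enormC F1 expr1n rmorph1 [RHS]addrC addKr.
apply: le_trans (le_normcD _ _) _; rewrite normcN Normc.normc1 lerD2r.
by apply: le_trans (normc_cdot_le _ _) _; rewrite F1 mul1r.
Qed.

Lemma size_flip_columns (M : nat) (fs : seq 'cV[C]_M) :
  size (flip_columns fs) = size fs.
Proof.
by elim/last_ind: fs => // fs f; rewrite /flip_columns foldl_rcons !size_rcons => ->.
Qed.

Lemma nth_flip_columns (M : nat) (fs : seq 'cV[C]_M) (n : nat) :
  nth 0 (flip_columns fs) n = nth 0 fs n \/ nth 0 (flip_columns fs) n = - nth 0 fs n.
Proof.
elim/last_ind: fs => [|fs f IH]; first by left.
rewrite /flip_columns foldl_rcons -/(flip_columns fs) !nth_rcons size_flip_columns.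
(* Past the end of both lists, the two entries are the default 0. *)
case: ltngtP => // _; first by left.
rewrite /flip_next; case: (flip_columns fs) => [|g gs]; first by left.
by case: ifP; [left | right].
Qed.

(* By the parallelogram law, the shorter diagonal obeys this bound. *)
Lemma enorm_flip_next (M : nat) (gs : seq 'cV[C]_M) (f : 'cV[C]_M) :
  enorm (\sum_(g <- gs) g + flip_next gs f) ^+ 2
    <= enorm (\sum_(g <- gs) g) ^+ 2 + enorm f ^+ 2.
Proof.
rewrite -(ler_pMn2r (isT : 0 < 2)%N) -enorm_parallelogram mulr2n.
rewrite /flip_next; case: gs => [|g gs].
  (* With no earlier column the two diagonals have equal length. *)
  by rewrite big_nil add0r sub0r enormN.
case: ifP => [le|/negbT]; first by rewrite lerD2l ler_sqr ?nnegrE ?enorm_ge0.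
by rewrite -ltNge => /ltW le; rewrite lerD2r ler_sqr ?nnegrE ?enorm_ge0.
Qed.

Lemma sum_flip_columns_le (M : nat) (fs : seq 'cV[C]_M) :
  {in fs, forall f, enorm f = 1} ->
  enorm (\sum_(g <- flip_columns fs) g) ^+ 2 <= (size fs)%:R.
Proof.
elim/last_ind: fs => [|fs f IH] fs1; first by rewrite big_nil sqr_enormE big1 // => k _; rewrite mxE Normc.normc0 expr0n.
rewrite /flip_columns foldl_rcons -/(flip_columns fs) size_rcons -cats1 big_cat big_seq1 /=.
apply: le_trans (enorm_flip_next _ _) _.
rewrite (fs1 f) ?mem_rcons ?mem_head // expr1n -natr1 lerD2r.
by apply: IH => g gfs; rewrite fs1 // mem_rcons in_cons gfs orbT.
Qed.

(** Put $t = \sqrt n$. Squaring the claim, inserting the Welch bound and cancelling $t + 1$ through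
    $n - 1 = (t-1)(t+1)$ reduces it to [cubic]. *)
Lemma coherence_arith (m n mu : R) :
    1 <= m -> 0 <= mu -> m ^+ 2 + 3 * m + 3 <= n ->
    n ^+ 2 <= m * (n + n * (n - 1) * mu ^+ 2) ->
  (n - 1)^-1 * (Num.sqrt n + 1) <= mu / Num.sqrt m.
Proof.
move=> m1 mu0 mn welch.
set t := Num.sqrt n; set r := Num.sqrt m.
have t2 : t ^+ 2 = n by rewrite sqr_sqrtr; nra.
have r2 : r ^+ 2 = m by rewrite sqr_sqrtr; lra.
have t0 : 0 <= t by apply: sqrtr_ge0.
have r0 : 0 < r by rewrite sqrtr_gt0; lra.
(* Since $m^2 + 3m + 3 \ge (m+1)^2$. *)
have tm : m + 1 <= t by rewrite -ler_sqr ?nnegrE ?t2 //; [nra | lra].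
have n1 : 0 < n - 1 by nra.
have {welch} welch : n - m <= m * (n - 1) * mu ^+ 2.
  have n0 : 0 < n by lra.
  by rewrite -(ler_pM2l n0); nra.
(* The right side minus the left is exactly the sum of the products in [e1] and [e2] plus $3m$. *)
have cubic : (t + 1) * m ^+ 2 <= (n - m) * (t - 1).
  have e1 : 0 <= (n - (m ^+ 2 + 3 * m + 3)) * (t - 1) by apply: mulr_ge0; lra.
  have e2 : 0 <= (2 * m + 3) * (t - (m + 1)) by apply: mulr_ge0; lra.
  by rewrite -t2 in e1 *; nra.
rewrite ler_pdivlMr // -mulrA ler_pdivrMl //.
rewrite -ler_sqr ?nnegrE; last 2 first.
- by rewrite mulr_ge0 ?ltW //; lra.
- by rewrite mulr_ge0 // ltW.
(* The extra factor [m] makes the right side match [welch]. *)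
rewrite !exprMn r2 -(ler_pM2l (lt_le_trans ltr01 m1)).
apply: (@le_trans _ _ ((n - 1) * (n - m))).
  have -> : m * ((t + 1) ^+ 2 * m) = (t + 1) * ((t + 1) * m ^+ 2) by ring.
  have -> : (n - 1) * (n - m) = (t + 1) * ((n - m) * (t - 1)) by rewrite -t2; ring.
  by rewrite ler_wpM2l //; lra.
have -> : m * ((n - 1) ^+ 2 * mu ^+ 2) = (n - 1) * (m * (n - 1) * mu ^+ 2) by ring.
by rewrite ler_wpM2l // ltW.
Qed.

End Coherence.

Theorem theorem12 (R : realType) (M N : nat) (F : 'M[R[i]]_(M, N)) :
  unit_norm_frame F ->
  (M ^ 2 + 3 * M + 3 <= N)%N ->
  let G := linear_time_flipping F in
  [/\ unit_norm_frame G,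
      flipping_equivalent F G &
      average_coherence G <= worst_coherence G / Num.sqrt M%:R].
Proof.
move=> [rkF F1] MN G.
pose gs := flip_columns [seq col i F | i <- enum 'I_N].
have colG i : col i G = nth 0 gs i.
  by apply/colP => k; rewrite !mxE.
have nthF (i : 'I_N) : nth 0 [seq col i F | i <- enum 'I_N] i = col i F.
  by rewrite (nth_map i) ?size_enum_ord // nth_ord_enum.
have colG_F i : col i G = col i F \/ col i G = - col i F.
  by rewrite colG -nthF; apply: nth_flip_columns.
have G1 i : enorm (col i G) = 1 by case: (colG_F i) => ->; rewrite ?enormN F1.
(* The algorithm does not record its signs; they are recovered by comparing columns. *)
pose d := \row_i (if col i G == col i F then 1 else -1 : R[i]).
have d1 i : d 0 i = 1 \/ d 0 i = -1 by rewrite mxE; case: ifP; [left | right].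
have GE : G = F *m diag_mx d.
  apply/matrixP => k i; rewrite mul_mx_diag !mxE.
  have -> : nth 0 gs i k 0 = col i G k 0 by rewrite colG.
  case: eqP => [->|]; first by rewrite mxE mulr1.
  by case: (colG_F i) => // -> _; rewrite !mxE mulrN1.
have rkG : \rank G = M.
  rewrite GE mxrankMfree // row_free_unit unitmxE det_diag unitfE.
  by apply/prodf_neq0 => i _; case: (d1 i) => ->; rewrite ?oppr_eq0 oner_eq0.
have N0 : (0 < N)%N by apply: leq_trans MN; rewrite addnS.
have M0 : (0 < M)%N.
  (* If $M = 0$, the first column, which exists because $N > 0$, would have norm 0 instead of 1. *)
  case: (posnP M) => // M0; have := F1 (Ordinal N0).
  move/(congr1 (fun x => x ^+ 2)); rewrite sqr_enormE expr1n big1 => [/eqP|k].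
    by rewrite eq_sym oner_eq0.
  by have := ltn_ord k; rewrite {2}M0.
split => //; first by exists d.
apply: le_trans (average_coherence_le G1 N0) _.
have sumG : enorm (\sum_i col i G) <= Num.sqrt N%:R.
  rewrite -ler_sqr ?nnegrE ?sqrtr_ge0 ?enorm_ge0 // [leRHS]sqr_sqrtr ?ler0n //.
  have -> : \sum_i col i G = \sum_(g <- gs) g.
    rewrite (big_nth 0) big_mkord size_flip_columns size_map size_enum_ord.
    by apply: eq_bigr => i _.
  have := @sum_flip_columns_le R M [seq col i F | i <- enum 'I_N].
  rewrite size_map size_enum_ord => le_sum.
  by apply: le_sum => _ /mapP[i _ ->].
apply: le_trans (coherence_arith _ _ _ (welch_bound G1)).
- by rewrite ler_wpM2l ?lerD2r // invr_ge0 subr_ge0 ler1n.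
- by rewrite ler1n.
- exact: worst_coherence_ge0.
- by rewrite -natrX -natrM -!natrD ler_nat.
Qed.
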